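(* Let $1<p\le 2$ and let $X$ be a separable Banach space with Azuma type $p$. Then $X$ is linearly isomorphic to a $p$-uniformly smooth Banach space.
   Context: For an $X$-valued martingale $f=(f_j)_{j\ge0}$ (filtration with trivial $\mathscr{F}_0$) let $d_{j,f}=f_j-f_{j-1}$ and $f^*=\sup_{j\in\mathbb{N}}\|f_j-f_0\|$. $X$ has Azuma type $p$ if there is a constant $K>0$ such that for every $X$-valued martingale $f$ and every nonnegative predictable sequence $w=(w_j)_{j\ge1}$ ($w_j$ measurable w.r.t. $\mathscr{F}_{j-1}$) with $\|d_{j,f}\|\le w_j$ for all $j$, one has $\mathbb{P}\{f^*\ge r\}\le 2\exp\{-r^p/(K\|\sum_{j=1}^\infty w_j^p\|_\infty)\}$ for all $r>0$. A Banach space $Y$ is $p$-uniformly smooth if there is $s>0$ with $\rho_Y(\tau)\le s\tau^p$ for all $\tau>0$, where $\rho_Y(\tau)=\sup\{\frac{\|x+\tau y\|+\|x-\tau y\|}{2}-1:\|x\|=\|y\|=1\}$. *)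

(* Defs.v *)
From HB Require Import structures.
From mathcomp Require Import all_boot all_order all_algebra.
From mathcomp Require Import all_classical all_reals.
From mathcomp Require Import ereal topology normedtype sequences esum measure.
From mathcomp Require Import lebesgue_measure lebesgue_integral probability.
From mathcomp Require Import exp ess_sup_inf.

Set Implicit Arguments.
Unset Strict Implicit.
Unset Printing Implicit Defensive.

Import Order.TTheory GRing.Theory Num.Def Num.Theory.
Import numFieldNormedType.Exports.

Local Open Scope classical_set_scope.
Local Open Scope ring_scope.

(* A (real) Banach space is modelled by [completeNormedModType R], R : realType. *)

Definition separable_space (T : topologicalType) : Prop :=
  exists D : set T, countable D /\ dense D.

Definition filtration_trivial0 d (Omega : measurableType d)
  (F : nat -> set (set Omega)) : Prop :=
  [/\ forall j, sigma_algebra [set: Omega] (F j),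
      forall j, F j `<=` measurable,
      forall j, F j `<=` F j.+1 &
      F 0%N = [set A | A = set0 \/ A = [set: Omega]] ].

Definition borel_meas_wrt d (Omega : measurableType d) (T : topologicalType)
  (G : set (set Omega)) (g : Omega -> T) : Prop :=
  forall U : set T, open U -> G (g @^-1` U).

Definition cont_lin_functional (R : realType) (X : normedModType R)
  (phi : X -> R) : Prop :=
  continuous phi /\ (forall (a : R) (u v : X), phi (a *: u + v) = a * phi u + phi v).

(* X-valued martingale w.r.t. the filtration F: adapted (Borel measurable),
   Bochner integrable (measurable and integrable norm), and
   E[f_{j+1} | F_j] = f_j, expressed as: for every A in F_j,
   int_A f_{j+1} dP = int_A f_j dP, tested against all continuous linear
   functionals (equivalent to the Bochner-integral identity by Hahn-Banach). *)
Definition martingale (R : realType) (X : normedModType R) d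
  (Omega : measurableType d) (P : probability Omega R)
  (F : nat -> set (set Omega)) (f : nat -> Omega -> X) : Prop :=
  [/\ forall j, borel_meas_wrt (F j) (f j),
      forall j, P.-integrable [set: Omega] (fun w => (`|f j w|)%:E) &
      forall j (phi : X -> R), cont_lin_functional phi ->
        forall A, F j A ->
          (\int[P]_(w in A) (phi (f j.+1 w))%:E =
           \int[P]_(w in A) (phi (f j w))%:E)%E ].

(* Azuma type p.  The predictable weights are w_j, j >= 1, with w_j
   F_{j-1}-measurable.  The condition ||sum_j w_j^p||_oo <= M is expressed via
   the essential supremum; f^* = sup_j ||f_j - f_0|| (an extended real). *)
Definition azuma_type (R : realType) (X : normedModType R) (p : R) : Prop :=
  exists K : R, 0 < K /\
  forall d (Omega : measurableType d) (P : probability Omega R)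
         (F : nat -> set (set Omega)) (f : nat -> Omega -> X)
         (w : nat -> Omega -> R),
    filtration_trivial0 F ->
    martingale P F f ->
    (forall j, borel_meas_wrt (F j) (w j.+1)) ->
    (forall j x, 0 <= w j.+1 x) ->
    (forall j x, `|f j.+1 x - f j x| <= w j.+1 x) ->
    forall M : R, 0 < M ->
    (ess_sup P (fun x => \sum_(1 <= j <oo) ((w j x) `^ p)%:E) <= M%:E)%E ->
    forall r : R, 0 < r ->
    (P [set x | (r%:E <= ereal_sup (range (fun j => (`|f j x - f 0%N x|)%:E)))%E]
      <= (2 * expR (- (r `^ p) / (K * M)))%:E)%E.

Definition modulus_smoothness (R : realType) (Y : normedModType R) (tau : R)
  : \bar R :=
  ereal_sup [set ((`|x + tau *: y| + `|x - tau *: y|) / 2 - 1)%:E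
            | x in [set x : Y | `|x| = 1] & y in [set y : Y | `|y| = 1]]%classic.

Definition p_uniformly_smooth (R : realType) (Y : normedModType R) (p : R)
  : Prop :=
  exists s : R, 0 < s /\
    forall tau : R, 0 < tau -> (modulus_smoothness Y tau <= (s * tau `^ p)%:E)%E.

Definition lin_isomorphic (R : realType) (X Y : normedModType R) : Prop :=
  exists (T : X -> Y) (S : Y -> X),
    [/\ forall (a : R) (u v : X), T (a *: u + v) = a *: T u + T v,
        continuous T, continuous S, cancel T S & cancel S T].

(* Main.v *)
Require Import Defs.
From HB Require Import structures.
From mathcomp Require Import all_boot all_order all_algebra.
From mathcomp Require Import all_classical all_reals.
From mathcomp Require Import ereal topology normedtype sequences numfun measure.
From mathcomp Require Import measurable_realfun lebesgue_integral probability.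
From mathcomp Require Import exp ess_sup_inf.
From mathcomp Require Import ring lra.

(** Only Paley-Walsh martingales, whose differences have the form [+- v_j] with
    [v_j] predictable, are needed.  Let [phi x] be the supremum of [E |x + f|]
    over the finite such martingales [f] started at [0] with
    [sum_j |v_j|^p <= 1] surely; integrating the Azuma tail bound shows that it
    is finite.  It is convex, even, 1-Lipschitz and dominates the norm.
    Preceding a pair of martingales by a coin flip [+- y] yields a martingale of
    budget [1 + |y|^p =: l^p], that is, [l] times one of budget [1]; so the mean
    of [phi (x + y)] and [phi (x - y)] is at most [l * phi (x / l)], which is
    [<= phi x + (l - 1) * phi 0 <= phi x + phi 0 * |y|^p] by convexity.
    The new norm is the gauge of [{phi <= phi 0 + 1}]. *)

Set Implicit Arguments.
Unset Strict Implicit.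
Unset Printing Implicit Defensive.

Import Order.TTheory GRing.Theory Num.Def Num.Theory.
Import numFieldNormedType.Exports.

Local Open Scope classical_set_scope.
Local Open Scope ring_scope.

(** * Replacing the norm of a Banach space by an equivalent one *)

Record equivalent_norm (R : realType) (X : normedModType R) := EquivalentNorm {
  enorm :> X -> R;
  enormD : forall x y, enorm (x + y) <= enorm x + enorm y;
  enormZ : forall a x, enorm (a *: x) = `|a| * enorm x;
  enorm_le : forall x, enorm x <= `|x|;
  enorm_bound : R;
  enorm_bound_gt0 : 0 < enorm_bound;
  le_enorm : forall x, `|x| <= enorm_bound * enorm x }.

(** A copy of [X] under its own head constant, so that the new norm can be attached to it without
    clashing with the norm of [X]. *)
Definition renormed (R : realType) (X : normedModType R)
  (N : equivalent_norm X) : Type := X.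

Section renormed_normedMod.
Context {R : realType} {X : normedModType R} (N : equivalent_norm X).

HB.instance Definition _ := GRing.Lmodule.on (renormed N).

Lemma enorm_eq0 (x : renormed N) : N x = 0 -> x = 0.
Proof.
move=> Nx0; have := le_enorm N x; rewrite Nx0 mulr0 => x0.
by apply/eqP; rewrite -(@normr_eq0 _ X) eq_le x0 normr_ge0.
Qed.

HB.instance Definition _ := Lmodule_isNormed.Build R (renormed N)
  (@enormD R X N) (@enormZ R X N) enorm_eq0.

Lemma renormed_normE (x : renormed N) : `|x| = N x.
Proof. by []. Qed.

End renormed_normedMod.

Section renormed_complete.
Context {R : realType} {X : completeNormedModType R} (N : equivalent_norm X).

Let toY (x : X) : renormed N := x.
Let toX (x : renormed N) : X := x.

Lemma renormed_continuous : continuous toY.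
Proof.
move=> x; apply/cvgrPdist_lt => e e0; near=> y.
rewrite renormed_normE (le_lt_trans (enorm_le N _))//.
by near: y; exact: cvgr_dist_lt.
Unshelve. all: by end_near. Qed.

Lemma renormed_inv_continuous : continuous toX.
Proof.
move=> x; have L0 := enorm_bound_gt0 N.
apply/(@cvgrPdist_lt _ X _ _ (nbhs_filter (x : renormed N))) => e e0.
have e'0 : 0 < (enorm_bound N)^-1 * e by rewrite mulr_gt0 ?invr_gt0.
have := @cvgr_dist_lt _ (renormed N) _ (nbhs x)
  (nbhs_filter x) id x cvg_id _ e'0.
apply: (@filterS _ _ (nbhs_filter (x : renormed N))) => y xy.
by rewrite (le_lt_trans (le_enorm N _))// -ltr_pdivlMl.
Qed.

(** By [le_enorm], a Cauchy filter for the new norm is Cauchy for the old one; its limit there is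
    also a limit for the new norm, since [toY] is continuous. *)
Lemma renormed_cauchy_cvg (F : set_system (renormed N)) :
  ProperFilter F -> cauchy F -> cvg F.
Proof.
move=> FF Fc.
have Xc : cauchy (toX @ F).
  apply/cauchy_ballP => e e0; have L0 := enorm_bound_gt0 N.
  have eL : 0 < e / enorm_bound N by rewrite divr_gt0.
  have /cauchy_ballP/(_ _ eL) := Fc.
  apply: filterS => -[a b] /=.
  rewrite -!ball_normE /= renormed_normE => ab.
  by rewrite (le_lt_trans (le_enorm N _))// -ltr_pdivlMl// mulrC.
have /cvg_ex[l Fl] : cvg (toX @ F) by exact: cauchy_cvg.
apply/cvg_ex; exists (toY l).
move=> A lA; apply: (Fl A); exact: (renormed_continuous lA).
Qed.

HB.instance Definition _ := Uniform_isComplete.Build (renormed N)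
  renormed_cauchy_cvg.

Definition renormed_space : completeNormedModType R := renormed N.

Lemma renormed_lin_isomorphic : lin_isomorphic X renormed_space.
Proof.
exists toY, toX; split => //.
- exact: renormed_continuous.
- exact: renormed_inv_continuous.
Qed.

End renormed_complete.

(** * The gauge of a sublevel set of a smooth convex function is a smooth norm *)

Section gauge_renorming.
Context {R : realType} {X : normedModType R} (p C : R) (phi : X -> R).
Hypothesis p1 : 1 < p.
Hypothesis C0 : 0 <= C.
Hypothesis phi_convex : forall (a b : R) (x y : X), 0 <= a -> 0 <= b ->
  a + b = 1 -> phi (a *: x + b *: y) <= a * phi x + b * phi y.
Hypothesis phiN : forall x, phi (- x) = phi x.
Hypothesis phi_lip : forall x y, phi (x + y) <= phi x + `|y|.
Hypothesis phi_ge : forall x, `|x| <= phi x.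
Hypothesis phi_smooth : forall x y,
  phi (x + y) + phi (x - y) <= 2 * phi x + 2 * C * `|y| `^ p.

(** One unit above [phi 0]: since [phi] is 1-Lipschitz, the sublevel set contains the unit ball;
    since [phi] dominates the norm, it lies in the ball of radius [L]. *)
Let L := phi 0 + 1.

Definition gauge (x : X) : R := inf [set l | 0 < l /\ phi (l^-1 *: x) <= L].

Lemma gauge_level_ge1 : 1 <= L.
Proof. by have := phi_ge 0; rewrite normr0 /L => h; lra. Qed.

Let L1 := gauge_level_ge1.

Let gauge_set_lb x l : 0 < l -> phi (l^-1 *: x) <= L -> `|x| <= L * l.
Proof.
move=> l0 /(le_trans (phi_ge _)).
by rewrite normrZ gtr0_norm ?invr_gt0// ler_pdivrMl// mulrC.
Qed.

Let gauge_set_ub x l : 0 < l -> `|x| <= l -> phi (l^-1 *: x) <= L.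
Proof.
move=> l0 xl; rewrite -[l^-1 *: x]add0r (le_trans (phi_lip _ _))// lerD2l.
by rewrite normrZ gtr0_norm ?invr_gt0// ler_pdivrMl// mulr1.
Qed.

Let has_inf_gauge x : has_inf [set l | 0 < l /\ phi (l^-1 *: x) <= L].
Proof.
split; last by exists 0 => l [/ltW].
have x1 : 0 < `|x| + 1 by rewrite ltr_wpDl.
by exists (`|x| + 1); split => //; apply: gauge_set_ub => //; rewrite lerDl.
Qed.

Lemma phi_scale_le (t : R) x : 0 <= t <= 1 ->
  phi (t *: x) <= t * phi x + (1 - t) * phi 0.
Proof.
move=> /andP[t0 t1]; rewrite -[t *: x]addr0 -[X in _ + X](scaler0 _ (1 - t)).
by apply: phi_convex; rewrite ?subr_ge0// addrC subrK.
Qed.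

Lemma gauge_le x l : 0 < l -> phi (l^-1 *: x) <= L -> gauge x <= l.
Proof. by move=> l0 xl; apply: ge_inf; [case: (has_inf_gauge x)|]. Qed.

(** Admissible scalings are closed upwards: for [k < l], the point [x / l] lies between 0 and
    [x / k], both in the convex sublevel set. *)
Lemma gauge_lt x l : gauge x < l -> 0 < l /\ phi (l^-1 *: x) <= L.
Proof.
move=> /(inf_lt (has_inf_gauge x).1)[k [k0 xk] kl].
have l0 := lt_trans k0 kl; split => //.
have -> : l^-1 *: x = (k / l) *: (k^-1 *: x).
  by rewrite scalerA mulrAC divff ?gt_eqF// mul1r.
have kl1 : k / l <= 1 by rewrite ler_pdivrMr// mul1r ltW.
have kl0 : 0 <= k / l by rewrite divr_ge0 ?ltW.
have kl01 : 0 <= k / l <= 1 by rewrite kl0.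
apply: (le_trans (phi_scale_le (k^-1 *: x) kl01)).
have : phi 0 <= L by rewrite lerDl.
by move: (phi _) (k / l) xk kl0 kl1 => u t; nra.
Qed.

Lemma gauge_le_norm x : gauge x <= `|x|.
Proof.
apply/ler_addgt0Pr => e e0.
have xe : 0 < `|x| + e by rewrite ltr_wpDl.
by apply: gauge_le => //; apply: gauge_set_ub => //; rewrite lerDl ltW.
Qed.

Lemma norm_le_gauge x : `|x| <= L * gauge x.
Proof.
have L0 : 0 < L by rewrite (lt_le_trans ltr01).
rewrite -ler_pdivrMl//; apply: lb_le_inf; first exact: (has_inf_gauge x).1.
by move=> l [l0 xl]; rewrite ler_pdivrMl//; apply: gauge_set_lb.
Qed.

Lemma gauge_ge0 x : 0 <= gauge x.
Proof.
have L0 : 0 < L by rewrite (lt_le_trans ltr01).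
by rewrite -(pmulr_rge0 _ L0) (le_trans _ (norm_le_gauge x)).
Qed.

Lemma gaugeD x y : gauge (x + y) <= gauge x + gauge y.
Proof.
apply/ler_addgt0Pr => e e0.
have [] := @gauge_lt x (gauge x + e / 2); first by rewrite ltrDl divr_gt0.
have [] := @gauge_lt y (gauge y + e / 2); first by rewrite ltrDl divr_gt0.
set k := gauge y + _; set l := gauge x + _ => k0 yk l0 xl.
have -> : gauge x + gauge y + e = l + k by rewrite /l /k; field.
have lk : 0 < l + k by rewrite addr_gt0.
apply: gauge_le => //.
have -> : (l + k)^-1 *: (x + y) =
  (l / (l + k)) *: (l^-1 *: x) + (k / (l + k)) *: (k^-1 *: y).
  rewrite !scalerA scalerDr; congr (_ *: _ + _ *: _);
    by field; rewrite !gt_eqF.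
have a0 : 0 <= l / (l + k) by rewrite divr_ge0 ?ltW.
have b0 : 0 <= k / (l + k) by rewrite divr_ge0 ?ltW.
have ab : l / (l + k) + k / (l + k) = 1 by field; rewrite gt_eqF.
apply: (le_trans (phi_convex _ _ a0 b0 ab)).
rewrite -[leRHS]mul1r -ab [leRHS]mulrDl.
by apply: lerD; apply: ler_wpM2l.
Qed.

Let gaugeZ_le a x : a != 0 -> gauge (a *: x) <= `|a| * gauge x.
Proof.
move=> a0; have na : 0 < `|a| by rewrite normr_gt0.
apply/ler_addgt0Pr => e e0.
have [] := @gauge_lt x (gauge x + e / `|a|); first by rewrite ltrDl divr_gt0.
set l := gauge x + _ => l0 xl.
have -> : `|a| * gauge x + e = `|a| * l.
  by rewrite /l mulrDr mulrCA divff ?mulr1 ?gt_eqF.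
apply: gauge_le; first by rewrite mulr_gt0.
have -> : (`|a| * l)^-1 *: (a *: x) = Num.sg a *: (l^-1 *: x).
  rewrite !scalerA; congr (_ *: _); rewrite {2}(numEsg a).
  by field; rewrite !gt_eqF.
by case: sgrP a0; rewrite ?eqxx// ?scale1r// scaleN1r phiN.
Qed.

Lemma gaugeZ a x : gauge (a *: x) = `|a| * gauge x.
Proof.
have [->|a0] := eqVneq a 0.
  rewrite scale0r normr0 mul0r; apply/eqP; rewrite eq_le gauge_ge0 andbT.
  by rewrite (le_trans (gauge_le_norm _))// normr0.
apply/eqP; rewrite eq_le gaugeZ_le//=.
rewrite -ler_pdivlMl ?normr_gt0//.
have : gauge (a^-1 *: (a *: x)) <= `|a^-1| * gauge (a *: x).
  by rewrite gaugeZ_le// invr_eq0.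
by rewrite scalerA mulVf// scale1r normrV ?unitfE.
Qed.

Definition gauge_norm : equivalent_norm X :=
  EquivalentNorm gaugeD gaugeZ gauge_le_norm (lt_le_trans ltr01 L1)
    norm_le_gauge.

(** The infimum is not known to be attained, so [x] is first shrunk by [1 + d]; the Lipschitz bound
    pays for the way back. *)
Lemma phi_le_gauge1 x : gauge x = 1 -> phi x <= L.
Proof.
move=> x1; apply/ler_addgt0Pr => e e0.
set d := e / (`|x| + 1).
have d0 : 0 < d by rewrite divr_gt0// ltr_wpDl.
have [] := @gauge_lt x (1 + d); first by rewrite x1 ltrDl.
move=> d1 xd.
have -> : x = (1 + d)^-1 *: x + (d / (1 + d)) *: x.
  rewrite -scalerDl -[LHS]scale1r; congr (_ *: _).
  by field; rewrite gt_eqF.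
apply: (le_trans (phi_lip _ _)); apply: lerD => //.
rewrite normrZ ger0_norm ?divr_ge0 ?ltW//.
have : d / (1 + d) <= d by rewrite ler_pdivrMr//; nra.
have : d * (`|x| + 1) = e by rewrite divfK// gt_eqF// ltr_wpDl.
move: (d / _) d0 (normr_ge0 x) => t; move: (`|x|) => n; nra.
Qed.

(** If [phi z < L], the Lipschitz bound leaves room to stretch [z] by [1 + d] inside the sublevel
    set, contradicting minimality of the gauge. *)
Lemma phi_ge_gauge x : 0 < gauge x -> L <= phi ((gauge x)^-1 *: x).
Proof.
move=> x0; rewrite leNgt; apply/negP; set z := _ *: x => zL.
set d := (L - phi z) / (`|z| + 1).
have z1 : 0 < `|z| + 1 by rewrite ltr_wpDl.
have d0 : 0 < d by rewrite divr_gt0// subr_gt0.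
have d1 : 0 < 1 + d by rewrite addr_gt0.
have : gauge x <= gauge x / (1 + d).
  apply: gauge_le; first by rewrite divr_gt0.
  rewrite invfM invrK mulrC -scalerA -/z scalerDl scale1r.
  rewrite (le_trans (phi_lip _ _))// normrZ (gtr0_norm d0).
  have : d * (`|z| + 1) = L - phi z by rewrite divfK// gt_eqF.
  by move: (`|z|) (normr_ge0 z) => n; nra.
by rewrite ler_pdivlMr// ger_pMr// gerDl leNgt d0.
Qed.

(** Passes from midpoints to arbitrary weights. For [b <= a], with [z] the weighted mean, [v] is
    [z - w] and [u] lies on the segment from [z] to [z + w]; convexity bounds [phi u], and
    smoothness at [z] in direction [w] does the rest. *)
Lemma phi_smooth_weighted (a b : R) (u v : X) : 0 <= a -> 0 <= b -> a + b = 1 ->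
  a * phi u + b * phi v <= phi (a *: u + b *: v) + 2 * C * `|u - v| `^ p.
Proof.
wlog ba : a b u v / b <= a.
  move=> H a0 b0 ab; have [/H|/ltW/H/(_ b0 a0)] := leP b a; first exact.
  move/(_ v u); rewrite (addrC b a) (addrC (b * _)) (addrC (b *: _)) distrC.
  exact.
move=> a0 b0 ab.
have a_gt0 : 0 < a by lra.
set z := a *: u + b *: v; set w := a *: (u - v).
have zwv : z - w = v.
  by rewrite /z /w scalerBr opprB addrC addrA subrK -scalerDl ab scale1r.
have uE : u = (b / a) *: (z + w) + (1 - b / a) *: z.
  rewrite scalerDr scalerBl scale1r addrC addrA subrK /w scalerA.
  rewrite divfK ?gt_eqF// scalerBr /z addrACA subrr addr0 -scalerDl ab.
  by rewrite scale1r.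
have ba0 : 0 <= b / a by rewrite divr_ge0.
have ba1 : 0 <= 1 - b / a by rewrite subr_ge0 ler_pdivrMr// mul1r.
have := phi_convex (z + w) z ba0 ba1; rewrite -uE addrC subrK => /(_ erefl) hu.
have := phi_smooth z w; rewrite zwv => hs.
have wp : `|w| `^ p <= `|u - v| `^ p.
  have p0 : 0 <= p by rewrite (le_trans ler01)// ltW.
  apply: ge0_ler_powR; rewrite ?nnegrE//.
  by rewrite /w normrZ ger0_norm// ler_piMl//; lra.
have Cw : C * `|w| `^ p <= C * `|u - v| `^ p by rewrite ler_wpM2l.
have q0 : 0 <= C * `|w| `^ p by rewrite mulr_ge0// powR_ge0.
have hu' : a * phi u <= b * phi (z + w) + (a - b) * phi z.
  have -> : b * phi (z + w) + (a - b) * phi z =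
    a * (b / a * phi (z + w) + (1 - b / a) * phi z) by field; rewrite gt_eqF.
  by rewrite ler_wpM2l.
move: hu' hs Cw q0; rewrite -!mulrA.
move: (phi u) (phi v) (phi z) (phi (z + w)) (C * _) (C * _) => f1 f2 f3 f4 c1 c2.
move=> h1 h2 h3 h4; have b1 : b <= 1 by lra.
nra.
Qed.

(** Let [m] be the mean of the gauges [a] and [b]. When [tau < 1 / 2] and [m > 1], weighted
    smoothness bounds [phi (x / m)] from below by [L] up to order [tau ^ p], while convexity bounds
    it from above by [L - (1 - 1 / m)]; so [m - 1] is of order [tau ^ p]. *)
Lemma gauge_smooth : exists s : R, 0 < s /\
  forall (x y : X) (tau : R), 0 < tau -> gauge x = 1 -> gauge y = 1 ->
    (gauge (x + tau *: y) + gauge (x - tau *: y)) / 2 - 1 <= s * tau `^ p.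
Proof.
have L0 : 0 < L by rewrite (lt_le_trans ltr01).
have p0 : 0 <= p by rewrite (le_trans ler01)// ltW.
(* [20 * L * tau] will bound the distance of [u] and [v]; the 3 is the factor 2 of
   [phi_smooth_weighted] times the bound [3 / 2] on [m]. The summand [2 ^ p] below serves large
   [tau]. *)
set D := 3 * C * (20 * L) `^ p.
have D0 : 0 <= D by rewrite !mulr_ge0// powR_ge0.
exists (2 `^ p + D); split; first by rewrite ltr_pwDl// powR_gt0.
move=> x y tau tau0 x1 y1; set a := gauge (x + _); set b := gauge (x - _).
have aU : a <= 1 + tau.
  by rewrite (le_trans (gaugeD _ _))// gaugeZ x1 y1 mulr1 gtr0_norm.
have bU : b <= 1 + tau.
  by rewrite (le_trans (gaugeD _ _))// -scaleNr gaugeZ x1 y1 mulr1 normrN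
    gtr0_norm.
have tp0 : 0 <= tau `^ p := powR_ge0 _ _.
(* For large [tau] the triangle inequality suffices: the left side is at most [tau], and
   [2 * tau >= 1] is at most its [p]-th power. *)
have [tau_ge|tau_lt] := leP (1 / 2) tau.
  have : 2 * tau <= (2 * tau) `^ p.
    rewrite -[leLHS]powRr1; last by lra.
    by apply: ler_powR; [lra|exact: ltW].
  rewrite powRM ?(ltW tau0)// [(_ + D) * _]mulrDl => h.
  have : 0 <= D * tau `^ p by rewrite mulr_ge0.
  lra.
have aL : 1 - tau <= a.
  have : gauge x <= a + gauge (- tau *: y).
    by rewrite (le_trans _ (gaugeD _ _))// scaleNr addrK.
  by rewrite gaugeZ x1 y1 mulr1 normrN gtr0_norm//; lra.
have bL : 1 - tau <= b.
  have : gauge x <= b + gauge (tau *: y).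
    by rewrite (le_trans _ (gaugeD _ _))// subrK.
  by rewrite gaugeZ x1 y1 mulr1 gtr0_norm//; lra.
have t2 : 0 <= 2 `^ p * tau `^ p by rewrite mulr_ge0// powR_ge0.
have Dt : 0 <= D * tau `^ p by rewrite mulr_ge0.
rewrite [(_ + D) * _]mulrDl; set m := (a + b) / 2.
have a0 : 0 < a by lra.
have b0 : 0 < b by lra.
have [m1|m1] := leP m 1; first by lra.
have m0 : 0 < m by lra.
(* [x / m] is a convex combination of the points [u], [v] of the unit sphere. *)
set u := a^-1 *: (x + tau *: y); set v := b^-1 *: (x - tau *: y).
have huL : L <= phi u by exact: phi_ge_gauge.
have hvL : L <= phi v by exact: phi_ge_gauge.
have ab : a / (2 * m) + b / (2 * m) = 1.
  by rewrite /m; field; rewrite gt_eqF// addr_gt0.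
have m20 : 0 < 2 * m by exact: mulr_gt0.
have am0 : 0 <= a / (2 * m) := divr_ge0 (ltW a0) (ltW m20).
have bm0 : 0 <= b / (2 * m) := divr_ge0 (ltW b0) (ltW m20).
have := phi_smooth_weighted u v am0 bm0 ab.
have -> : (a / (2 * m)) *: u + (b / (2 * m)) *: v = m^-1 *: x.
  rewrite /u /v !scalerA.
  have -> : a / (2 * m) / a = (2 * m)^-1 by field; rewrite !gt_eqF.
  have -> : b / (2 * m) / b = (2 * m)^-1 by field; rewrite !gt_eqF.
  rewrite -scalerDr addrACA subrr addr0 -[x + x]mulr2n -[x *+ 2]scaler_nat.
  rewrite scalerA.
  by congr (_ *: _); field; rewrite gt_eqF.
(* From [|b - a| <= 2 * tau], [a + b <= 3] and [a * b >= 1 / 4], the gauge of [u - v] is at most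
   [(2 + 3) * 4 * tau]. *)
have uv : `|u - v| <= 20 * L * tau.
  rewrite (le_trans (norm_le_gauge _))// [20 * L]mulrC -mulrA.
  rewrite ler_wpM2l ?(ltW L0)//.
  have -> : u - v = ((b - a) / (a * b)) *: x + ((a + b) * tau / (a * b)) *: y.
    rewrite /u /v !scalerDr !scalerA scalerN opprD opprK addrACA.
    rewrite -scalerBl !scalerA -scalerDl.
    by congr (_ *: _ + _ *: _); field; rewrite !gt_eqF.
  rewrite (le_trans (gaugeD _ _))// !gaugeZ x1 y1 !mulr1.
  have ab0 : 0 < a * b by rewrite mulr_gt0.
  rewrite !normrM normfV (gtr0_norm ab0) (gtr0_norm tau0).
  rewrite (gtr0_norm (addr_gt0 a0 b0)) -mulrDl ler_pdivrMr//.
  have : `|b - a| <= 2 * tau by rewrite ler_norml; apply/andP; split; lra.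
  have : 1 / 4 <= a * b by nra.
  by move: (`|b - a|) (a * b) => r q ? ?; nra.
have uvp : `|u - v| `^ p <= (20 * L) `^ p * tau `^ p.
  have L20 : 0 <= 20 * L by rewrite mulr_ge0// ltW.
  rewrite -powRM ?(ltW tau0)//.
  by apply: ge0_ler_powR; rewrite ?nnegrE// mulr_ge0// ltW.
have Cuv : C * `|u - v| `^ p <= C * ((20 * L) `^ p * tau `^ p).
  by rewrite ler_wpM2l.
have mi : 0 <= m^-1 <= 1 by rewrite invr_ge0 (ltW m0)/= invf_le1// ltW.
case/andP: (mi) => mi0 mi1.
(* As [phi 0 = L - 1], moving from [x] towards 0 by the fraction [1 - 1 / m] lowers the bound [L] by
   that same amount. *)
have hm : phi (m^-1 *: x) <= L - (1 - m^-1).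
  apply: (le_trans (phi_scale_le x mi)).
  have := ler_wpM2l mi0 (phi_le_gauge1 x1); rewrite /L.
  by move: (m^-1) (phi x) => k f; lra.
have hu := ler_wpM2l am0 huL; have hv := ler_wpM2l bm0 hvL.
have hL : a / (2 * m) * L + b / (2 * m) * L = L by rewrite -mulrDl ab mul1r.
move=> hw; have hq : 1 - m^-1 <= 2 * (C * ((20 * L) `^ p * tau `^ p)).
  move: hL hu hv hw; move: (a / _ * _) (b / _ * _) (_ * phi u) (_ * phi v).
  by move=> g1 g2 g3 g4; lra.
have mm : m - 1 = m * (1 - m^-1) by rewrite mulrBr mulr1 divff// gt_eqF.
have m32 : m <= 3 / 2 by rewrite /m; lra.
have q0 : 0 <= 2 * (C * ((20 * L) `^ p * tau `^ p)).
  by rewrite !mulr_ge0// powR_ge0.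
have := ler_wpM2l (ltW m0) hq; rewrite -mm => hm1.
have := ler_wpM2r q0 m32; rewrite /D; lra.
Qed.

End gauge_renorming.

(** * Paley-Walsh trees, their means and their costs *)

(* A finite Paley-Walsh martingale as a tree: [Flip y a b] moves by [y] and goes
   on as [a], or by [- y] and goes on as [b], with probability 1/2 each. *)
Inductive walsh (V : Type) := Stop | Flip of V & walsh V & walsh V.
Arguments Stop {V}.

Section walsh_mean.
Context {R : realType} {X : normedModType R} (p : R).
Implicit Types (t : walsh X) (x y : X).

(** The expectation of [|x + f|], where [f] is the final value of the martingale coded by [t]. *)
Fixpoint walsh_mean t x : R := match t with
  | Stop => `|x|
  | Flip y a b => (walsh_mean a (x + y) + walsh_mean b (x - y)) / 2
  end.

(** The largest value, over all branches, of the sum of the [p]-th powers of the step norms. *)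
Fixpoint walsh_cost t : R := match t with
  | Stop => 0
  | Flip y a b => `|y| `^ p + Num.max (walsh_cost a) (walsh_cost b)
  end.

Fixpoint walsh_scale (c : R) t : walsh X := match t with
  | Stop => Stop
  | Flip y a b => Flip (c *: y) (walsh_scale c a) (walsh_scale c b)
  end.

Lemma walsh_mean_scale c t x :
  walsh_mean (walsh_scale c t) (c *: x) = `|c| * walsh_mean t x.
Proof.
elim: t x => [|y a iha b ihb] x /=; first by rewrite normrZ.
by rewrite -scalerDr -scalerBr iha ihb -mulrDr mulrA.
Qed.

Lemma walsh_cost_scale c t :
  walsh_cost (walsh_scale c t) = `|c| `^ p * walsh_cost t.
Proof.
elim: t => [|y a iha b ihb] /=; first by rewrite mulr0.
by rewrite iha ihb normrZ powRM// mulrDr maxr_pMr// powR_ge0.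
Qed.

Lemma walsh_mean_lip t x y : walsh_mean t (x + y) <= walsh_mean t x + `|y|.
Proof.
elim: t x => [|z a iha b ihb] x /=; first exact: ler_normD.
by have := iha (x + z); have := ihb (x - z); rewrite !(addrAC x _ y); lra.
Qed.

Lemma walsh_mean_convex t (a b : R) x y : 0 <= a -> 0 <= b -> a + b = 1 ->
  walsh_mean t (a *: x + b *: y) <= a * walsh_mean t x + b * walsh_mean t y.
Proof.
move=> a0 b0 ab; elim: t x y => [|z t iht s ihs] x y /=.
  by rewrite (le_trans (ler_normD _ _))// !normrZ !ger0_norm.
have E w : a *: x + b *: y + w = a *: (x + w) + b *: (y + w).
  by rewrite !scalerDr addrACA -scalerDl ab scale1r.
by have := iht (x + z) (y + z); have := ihs (x - z) (y - z); rewrite !E; lra.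
Qed.

Lemma walsh_cost_ge0 t : 0 <= walsh_cost t.
Proof.
elim: t => [//|y a iha b ihb] /=.
by rewrite addr_ge0 ?powR_ge0// le_max iha.
Qed.

End walsh_mean.

(** * The supremum of the means over trees of cost at most 1 *)

Section walsh_sup.
Context {R : realType} {X : normedModType R} (p C0 : R).
Hypothesis p1 : 1 < p.
Hypothesis mean_bounded : forall t : walsh X,
  walsh_cost p t <= 1 -> walsh_mean t 0 <= C0.

Definition walsh_sup (x : X) : R :=
  sup [set walsh_mean t x | t in [set t : walsh X | walsh_cost p t <= 1]].

Let has_sup_walsh x :
  has_sup [set walsh_mean t x | t in [set t : walsh X | walsh_cost p t <= 1]].
Proof.
split; first by exists (walsh_mean Stop x), Stop => //=; exact: ler01.
exists (C0 + `|x|) => _ [t /= t1 <-].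
rewrite -[X in walsh_mean t X]add0r (le_trans (walsh_mean_lip _ _ _))//.
by rewrite lerD2r mean_bounded.
Qed.

Lemma le_walsh_sup t x : walsh_cost p t <= 1 -> walsh_mean t x <= walsh_sup x.
Proof.
by move=> t1; apply: ub_le_sup; [exact: (has_sup_walsh x).2|exists t].
Qed.

Lemma walsh_sup_le x B :
  (forall t, walsh_cost p t <= 1 -> walsh_mean t x <= B) -> walsh_sup x <= B.
Proof.
move=> H; apply: ge_sup; first exact: (has_sup_walsh x).1.
by move=> _ [t /= t1 <-]; exact: H.
Qed.

Lemma walsh_sup_lip x y : walsh_sup (x + y) <= walsh_sup x + `|y|.
Proof.
apply: walsh_sup_le => t t1; apply: (le_trans (walsh_mean_lip _ _ _)).
by rewrite lerD2r le_walsh_sup.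
Qed.

Lemma walsh_sup_convex (a b : R) x y : 0 <= a -> 0 <= b -> a + b = 1 ->
  walsh_sup (a *: x + b *: y) <= a * walsh_sup x + b * walsh_sup y.
Proof.
move=> a0 b0 ab; apply: walsh_sup_le => t t1.
apply: (le_trans (walsh_mean_convex _ _ _ a0 b0 ab)).
by apply: lerD; apply: ler_wpM2l => //; exact: le_walsh_sup.
Qed.

Lemma norm_le_walsh_sup x : `|x| <= walsh_sup x.
Proof.
by apply: (@le_walsh_sup Stop) => //=; exact: ler01.
Qed.

Lemma walsh_supN x : walsh_sup (- x) = walsh_sup x.
Proof.
have H y : walsh_sup (- y) <= walsh_sup y.
  apply: walsh_sup_le => t t1; rewrite -[walsh_mean _ _]mul1r -(normr1 R).
  rewrite -normrN -walsh_mean_scale scaleN1r opprK le_walsh_sup//.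
  by rewrite walsh_cost_scale normrN normr1 powR1 mul1r.
by apply/eqP; rewrite eq_le H/= -{1}[x]opprK H.
Qed.

(* A tree of cost at most l^p is l times a tree of cost at most 1. *)
Lemma walsh_mean_le_perspective (l : R) t x :
  1 <= l -> walsh_cost p t <= l `^ p ->
  walsh_mean t x <= walsh_sup x + (l - 1) * walsh_sup 0.
Proof.
move=> l1 tl; have l0 : 0 < l by rewrite (lt_le_trans ltr01).
have lV : 0 <= l^-1 by rewrite invr_ge0 ltW.
have lV1 : 0 <= 1 - l^-1 by rewrite subr_ge0 invf_le1.
have : walsh_mean (walsh_scale l^-1 t) (l^-1 *: x) <= walsh_sup (l^-1 *: x).
  apply: le_walsh_sup; rewrite walsh_cost_scale ger0_norm//.
  have lp : 0 < l `^ p by rewrite powR_gt0.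
  rewrite -(@ler_pM2l _ (l `^ p))// mulrA -powRM// ?(ltW l0)//.
  by rewrite divff ?gt_eqF// powR1 mul1r mulr1.
rewrite walsh_mean_scale ger0_norm// => h1.
(* Convexity between [x] and 0 bounds the value at [x / l]; multiplying by [l] leaves the surplus
   [(l - 1) * walsh_sup 0]. *)
have := walsh_sup_convex x 0 lV lV1.
rewrite scaler0 addr0 addrC subrK => /(_ erefl) h2.
rewrite -(ler_pM2l (_ : 0 < l^-1)) ?invr_gt0//.
apply: (le_trans h1); apply: (le_trans h2).
by rewrite mulrDr lerD2l mulrA mulrBr mulVf ?gt_eqF// mulr1.
Qed.

Lemma walsh_sup_smooth x y : walsh_sup (x + y) + walsh_sup (x - y) <=
  2 * walsh_sup x + 2 * walsh_sup 0 * `|y| `^ p.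
Proof.
set l := (1 + `|y| `^ p) `^ p^-1.
have p0 : 0 < p by rewrite (lt_trans ltr01).
have y0 : 0 <= `|y| `^ p := powR_ge0 _ _.
have lp : l `^ p = 1 + `|y| `^ p.
  by rewrite -powRrM mulVf ?gt_eqF// powRr1// addr_ge0.
have l1 : 1 <= l.
  have -> : 1 = 1 `^ p^-1 by rewrite powR1.
  apply: ge0_ler_powR.
  - by rewrite invr_ge0 ltW.
  - by rewrite nnegrE.
  - by rewrite nnegrE addr_ge0.
  - by rewrite lerDl.
(* Since [1 / p <= 1] and the base is at least 1, [l - 1] is at most the [p]-th power of the norm of
   [y]. *)
have lU : l <= 1 + `|y| `^ p.
  rewrite -[leRHS]powRr1 ?addr_ge0//; apply: ler_powR; first by rewrite lerDl.
  by rewrite invf_le1// ltW.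
have S0 : 0 <= walsh_sup 0.
  by rewrite (le_trans (normr_ge0 _) (norm_le_walsh_sup _)).
have key a b : walsh_cost p a <= 1 -> walsh_cost p b <= 1 ->
    walsh_mean a (x + y) + walsh_mean b (x - y) <=
    2 * walsh_sup x + 2 * walsh_sup 0 * `|y| `^ p.
  move=> a1 b1; have : walsh_cost p (Flip y a b) <= l `^ p.
    by rewrite lp /= addrC lerD2r ge_max a1.
  move/(walsh_mean_le_perspective x l1) => /=; nra.
(* The two suprema are taken one after the other, the tree [a] being fixed while [b] varies. *)
rewrite -lerBrDr; apply: walsh_sup_le => a a1; rewrite lerBrDr addrC -lerBrDr.
by apply: walsh_sup_le => b b1; rewrite lerBrDr addrC key.
Qed.

End walsh_sup.

(** * The uniform probability on finitely many coin flips *)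

Definition cube (n : nat) : Type := {ffun 'I_n.+1 -> bool}.

HB.instance Definition _ n := Finite.on (cube n).
HB.instance Definition _ n := isPointed.Build (cube n) [ffun=> false].
HB.instance Definition _ n := @isMeasurable.Build default_measure_display
  (cube n) discrete_measurable discrete_measurable0
  discrete_measurableC discrete_measurableU.

Section cube_uniform.
Context {R : realType} (n : nat).

Let c : R := #|{: cube n}|%:R^-1.
Let c_ge0 : 0 <= c. Proof. by rewrite invr_ge0. Qed.
Let dirac_at (k : nat) : {measure set (cube n) -> \bar R} :=
  mscale (NngNum c_ge0) (dirac (nth point (enum {: cube n}) k)).

(** A sum of equally weighted Dirac masses, so that integrals reduce to finite averages. *)
Definition cube_uniform : set (cube n) -> \bar R := msum dirac_at #|{: cube n}|.

HB.instance Definition _ := Measure.on cube_uniform.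

Let sum_enum (F : cube n -> R) :
  \sum_(k < #|{: cube n}|) F (nth point (enum {: cube n}) k) = \sum_w F w.
Proof. by rewrite -[RHS]big_enum (big_nth point) big_mkord -cardE. Qed.

Lemma cube_uniformE A :
  cube_uniform A = (#|{: cube n}|%:R^-1 * \sum_w (w \in A)%:R)%:E.
Proof.
rewrite /cube_uniform /msum /= -(sum_enum (fun w => (w \in A)%:R)) mulr_sumr.
by rewrite -sumEFin; apply: eq_bigr => k _; rewrite /mscale/= diracE.
Qed.

Let cube_uniformT : cube_uniform [set: cube n] = 1%E.
Proof.
rewrite cube_uniformE; under eq_bigr do rewrite in_setT.
rewrite sumr_const mulVf// pnatr_eq0 -lt0n.
by apply/card_gt0P; exists point.
Qed.

HB.instance Definition _ :=
  Measure_isProbability.Build _ _ _ cube_uniform cube_uniformT.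

Lemma measurable_cube (A : set (cube n)) : measurable A.
Proof. by []. Qed.

Lemma measurable_fun_cube d (T : measurableType d) (A : set (cube n))
  (f : cube n -> T) : measurable_fun A f.
Proof. by move=> mA B mB; exact: measurable_cube. Qed.

Let ge0_integral_cube A (f : cube n -> R) : (forall w, 0 <= f w) ->
  (\int[cube_uniform]_(w in A) (f w)%:E)%E =
  (#|{: cube n}|%:R^-1 * \sum_w (w \in A)%:R * f w)%:E.
Proof.
move=> f0; have mA := measurable_cube A.
have f0E w : A w -> (0 <= (f w)%:E)%E by rewrite lee_fin.
have mf : measurable_fun A (fun w => (f w)%:E) by exact: measurable_fun_cube.
rewrite ge0_integral_measure_sum//.
rewrite -(sum_enum (fun w => (w \in A)%:R * f w)) mulr_sumr -sumEFin.
apply: eq_bigr => k _; by rewrite ge0_integral_mscale// integral_dirac//.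
Qed.

Lemma integral_cube A (f : cube n -> R) :
  (\int[cube_uniform]_(w in A) (f w)%:E)%E =
  (#|{: cube n}|%:R^-1 * \sum_w (w \in A)%:R * f w)%:E.
Proof.
rewrite integralE.
under eq_integral do rewrite funeposE -EFin_max.
under [X in (_ - X)%E]eq_integral do rewrite funenegE -EFinN -EFin_max.
rewrite !ge0_integral_cube; last 2 first.
- by move=> w; rewrite le_max lexx orbT.
- by move=> w; rewrite le_max lexx orbT.
rewrite -EFinB -mulrBr -sumrB; congr (_ * _)%:E; apply: eq_bigr => w _.
rewrite -mulrBr; congr (_ * _).
by rewrite !maxEle; case: (leP (f w) 0); case: (leP (- f w) 0); lra.
Qed.

Lemma integrable_cube (f : cube n -> R) :
  cube_uniform.-integrable [set: cube n] (fun w => (f w)%:E).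
Proof.
apply/integrableP; split; first exact: measurable_fun_cube.
by under eq_integral do rewrite abse_EFin; rewrite integral_cube ltry.
Qed.

End cube_uniform.

(** * Following a tree along a sequence of flips *)

Section walsh_walk.
Context {R : realType} {X : normedModType R}.
Implicit Types (t : walsh X) (s : seq bool) (x : X).

(** A stopped tree goes on with zero increments, so that paths of any length make sense. *)
Definition walsh_incr t : X := if t is Flip y _ _ then y else 0.

Definition walsh_next t (c : bool) : walsh X :=
  if t is Flip _ a b then (if c then a else b) else Stop.

Definition walsh_step t (c : bool) : X :=
  if c then walsh_incr t else - walsh_incr t.

Fixpoint walsh_sub t s : walsh X :=
  if s is c :: s' then walsh_sub (walsh_next t c) s' else t.

Fixpoint walsh_walk t s : X :=
  if s is c :: s' then walsh_step t c + walsh_walk (walsh_next t c) s' else 0.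

Fixpoint walsh_depth t : nat := match t with
  | Stop => 0
  | Flip _ a b => (maxn (walsh_depth a) (walsh_depth b)).+1
  end.

Lemma walsh_sub_rcons t s c :
  walsh_sub t (rcons s c) = walsh_next (walsh_sub t s) c.
Proof. by elim: s t => [//|b s ih] t /=. Qed.

Lemma walsh_walk_rcons t s c :
  walsh_walk t (rcons s c) = walsh_walk t s + walsh_step (walsh_sub t s) c.
Proof.
by elim: s t => [|b s ih] t /=; rewrite ?add0r ?addr0// ih addrA.
Qed.

Lemma walsh_sub_depth t s : (walsh_depth t <= size s)%N -> walsh_sub t s = Stop.
Proof.
elim: s t => [|c s ih] [|y a b]//=.
  by move=> _; apply: ih.
by rewrite ltnS geq_max => /andP[? ?]; apply: ih; case: c.
Qed.

Lemma walsh_mean_next t x : walsh_mean t x =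
  (walsh_mean (walsh_next t true) (x + walsh_step t true) +
   walsh_mean (walsh_next t false) (x + walsh_step t false)) / 2.
Proof. by case: t => [|y a b]//=; rewrite /walsh_step/= oppr0 addr0; lra. Qed.

(** Induction on the tree: the first step pays for the root, and the shifted path [b \o S] continues
    in the chosen subtree. Positivity of [p] makes the zero steps after stopping free. *)
Lemma walsh_cost_branch p t (b : nat -> bool) m :
  0 < p ->
  \sum_(i < m) `|walsh_incr (walsh_sub t (mkseq b i))| `^ p <= walsh_cost p t.
Proof.
move=> p0; elim: t b m => [|y a iha c ihc] b m /=.
  rewrite big1// => i _; rewrite walsh_sub_depth//= normr0.
  by rewrite powR0 ?gt_eqF.
case: m => [|m].
  by rewrite big_ord0 addr_ge0 ?powR_ge0// le_max walsh_cost_ge0.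
rewrite big_ord_recl /= lerD2l.
have -> : \sum_(i < m) `|walsh_incr (walsh_sub (Flip y a c)
      (mkseq b (bump 0 i)))| `^ p =
    \sum_(i < m) `|walsh_incr (walsh_sub (if b 0 then a else c)
      (mkseq (b \o S) i))| `^ p.
  apply: eq_bigr => i _; rewrite /bump /mkseq /=.
  by rewrite (iotaDl 1 0) -map_comp.
by case: (b 0); rewrite le_max ?iha ?ihc ?orbT.
Qed.

End walsh_walk.

(** * The filtration of the coin flips and averaging over one coin *)

Section cube_walk.
Context {n : nat}.
Implicit Types (w : cube n) (j : nat).

(** Beyond the [n.+1] coins [inord] falls back to coin 0; this is harmless, since trees of depth at
    most [n.+1] have stopped by then. *)
Definition hist w j : seq bool := mkseq (fun i => w (inord i)) j.

Lemma histS w j : hist w j.+1 = rcons (hist w j) (w (inord j)).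
Proof. exact: mkseqS. Qed.

Lemma hist_le w w' j k : (j <= k)%N -> hist w k = hist w' k ->
  hist w j = hist w' j.
Proof.
move=> jk /(congr1 (take j)).
by rewrite -!map_take !take_iota (minn_idPl jk).
Qed.

(** The sigma-algebra generated by the first [j] flips, described as the sets saturated under
    equality of histories. *)
Definition cube_filtration j : set (set (cube n)) :=
  [set A | forall w w', hist w j = hist w' j -> A w -> A w'].

Lemma cube_filtration_preimage (T : Type) j k (g : seq bool -> T) (U : set T) :
  (k <= j)%N -> cube_filtration j ((fun w => g (hist w k)) @^-1` U).
Proof. by move=> kj w w' /(hist_le kj) /= ->. Qed.

Lemma cube_filtrationP : filtration_trivial0 cube_filtration.
Proof.
split.
- move=> j; split.
  + by move=> w w'.
  + by move=> A FA w w' ww' [_ Aw]; split => // /(FA w' w (esym ww')).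
  + by move=> A FA w w' ww' [k _ Aw]; exists k => //; exact: (FA k w).
- by [].
- by move=> j A FA w w' /(hist_le (leqnSn j)); exact: FA.
- apply/seteqP; split => A /=; last by case=> ->.
  move=> FA; have [->|/set0P[w Aw]] := eqVneq A set0; [by left|right].
  by apply/seteqP; split => // w' _; exact: (FA w).
Qed.

Definition flip j w : cube n := [ffun i => w i (+) (i == inord j)].

Lemma flipK j : involutive (flip j).
Proof. by move=> w; apply/ffunP => i; rewrite !ffunE -addbA addbb addbF. Qed.

Lemma hist_flip j w : (j <= n)%N -> hist (flip j w) j = hist w j.
Proof.
move=> jn; apply/eq_in_map => i; rewrite mem_iota add0n /= => ij.
rewrite ffunE -val_eqE /= !inordK ?ltnS ?(leq_trans (ltnW ij))//.
by rewrite ltn_eqF// addbF.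
Qed.

(** Toggling coin [j] permutes the cube and preserves both [A] and the earlier history; the sum is
    therefore the half-sum of itself and its toggled version. *)
Lemma cube_sum_step (R : realType) j A (G : seq bool -> R) :
  (j <= n)%N -> cube_filtration j A ->
  \sum_(w : cube n) (w \in A)%:R * G (hist w j.+1) =
  \sum_(w : cube n) (w \in A)%:R *
    ((G (rcons (hist w j) true) + G (rcons (hist w j) false)) / 2).
Proof.
move=> jn FA; set S := LHS.
have SE : S = \sum_(w : cube n) (w \in A)%:R *
    G (rcons (hist w j) (~~ w (inord j))).
  rewrite /S (reindex_inj (can_inj (flipK j))); apply: eq_bigr => w _.
  rewrite histS hist_flip// ffunE eqxx addbT.
  have -> // : (flip j w \in A) = (w \in A).
  by apply/idP/idP; rewrite !inE; apply: FA; rewrite hist_flip.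
have -> : S = (S + S) / 2 by lra.
rewrite {2}SE /S -big_split mulr_suml; apply: eq_bigr => w _ /=.
by rewrite histS; case: (w _) => /=; ring.
Qed.

End cube_walk.

(** * The martingale on the cube attached to a tree *)

Section walsh_martingale.
Context {R : realType} {X : normedModType R} (n : nat) (t : walsh X).
Hypothesis tn : (walsh_depth t <= n.+1)%N.

Definition cube_martingale (j : nat) (w : cube n) : X := walsh_walk t (hist w j).

Lemma cube_martingaleP :
  martingale (@cube_uniform R n) (@cube_filtration n) cube_martingale.
Proof.
split.
- by move=> j U _; exact: (@cube_filtration_preimage n X j j (walsh_walk t)).
- by move=> j; exact: integrable_cube.
- move=> j phi [_ phi_lin] A FA; rewrite !integral_cube; congr (_ * _)%:E.
  have phiD u v : phi (u + v) = phi u + phi v.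
    by rewrite -[u]scale1r phi_lin mul1r scale1r.
  have phi0 : phi 0 = 0.
    by apply: (@addrI _ (phi 0)); rewrite -phiD !addr0.
  have phiN u : phi (- u) = - phi u.
    by apply/eqP; rewrite -subr_eq0 opprK addrC -phiD subrr phi0.
  (* Up to time [n] coin [j] is fresh and its two signs cancel; afterwards no coin is fresh, but the
     tree has stopped. *)
  have [jn|nj] := leqP j n.
    rewrite /cube_martingale (cube_sum_step (phi \o walsh_walk t) jn FA).
    apply: eq_bigr => w _ /=; congr (_ * _).
    by rewrite !walsh_walk_rcons /walsh_step !phiD phiN; lra.
  apply: eq_bigr => w _; rewrite /cube_martingale histS walsh_walk_rcons.
  rewrite walsh_sub_depth; last by rewrite size_mkseq (leq_trans tn).
  by rewrite /walsh_step /= oppr0 if_same addr0.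
Qed.

(** The average over the cube of the mean of the remaining subtree, started at the current position,
    does not depend on [j]; times 0 and [n.+1] give the two sides. *)
Lemma walsh_mean_cube : walsh_mean t 0 =
  #|{: cube n}|%:R^-1 * \sum_(w : cube n) `|cube_martingale n.+1 w|.
Proof.
have step j : (j <= n.+1)%N ->
    #|{: cube n}|%:R * walsh_mean t 0 =
    \sum_(w : cube n)
      walsh_mean (walsh_sub t (hist w j)) (walsh_walk t (hist w j)).
  elim: j => [_|j ih jn]; first by rewrite /= sumr_const mulr_natl.
  rewrite ih; last exact: ltnW.
  have FT : cube_filtration j [set: cube n] by [].
  have := @cube_sum_step n R j setT
    (fun s => walsh_mean (walsh_sub t s) (walsh_walk t s)) jn FT.
  under eq_bigr do rewrite in_setT mul1r.
  under [in RHS]eq_bigr do rewrite in_setT mul1r.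
  move=> ->; apply: eq_bigr => w _.
  by rewrite walsh_mean_next !walsh_walk_rcons !walsh_sub_rcons.
have N0 : #|{: cube n}|%:R != 0 :> R.
  by rewrite pnatr_eq0 -lt0n; apply/card_gt0P; exists point.
apply: (mulfI N0); rewrite mulrA mulfV// mul1r (step n.+1)//.
apply: eq_bigr => w _; rewrite walsh_sub_depth// size_mkseq.
by [].
Qed.

End walsh_martingale.

(** * From the Azuma tail bound to a uniform bound on the means *)

Lemma azuma_walsh_tail (R : realType) (X : normedModType R) (p : R) :
  0 < p -> azuma_type X p -> exists K : R, 0 < K /\
  forall n (t : walsh X), (walsh_depth t <= n.+1)%N -> walsh_cost p t <= 1 ->
  forall r : R, 0 < r ->
  #|{: cube n}|%:R^-1 * \sum_(w : cube n) (r <= `|cube_martingale t n.+1 w|)%R%:R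
    <= 2 * expR (- (r `^ p) / K).
Proof.
move=> p0 [K [K0 azuma]]; exists K; split => // n t tn t1 r r0.
(* The [j]-th difference has the norm of the increment at the node reached after [j - 1] flips,
   hence a predictable weight. *)
pose weight (j : nat) (w : cube n) : R :=
  `|walsh_incr (walsh_sub t (hist w j.-1))|.
have := @azuma _ (cube n) (@cube_uniform R n) (@cube_filtration n)
  (cube_martingale t) weight (@cube_filtrationP n) (cube_martingaleP tn).
move=> /(_ _ _ _ 1 ltr01 _ r r0); rewrite mulr1 => H.
rewrite -lee_fin; apply: (le_trans _ (H _ _ _ _)).
(* The walk starts at 0, so its final norm is one of the terms in the supremum defining the maximal
   function. *)
- rewrite [leRHS]cube_uniformE lee_fin ler_wpM2l ?invr_ge0//.
  apply: ler_sum => w _; rewrite ler_nat; case: leP => // rw.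
  rewrite mem_set//=; apply: ereal_sup_ge.
  exists (`|cube_martingale t n.+1 w - cube_martingale t 0 w|)%:E.
    by exists n.+1.
  by rewrite lee_fin subr0.
- move=> j U _.
  exact: (@cube_filtration_preimage n R j j
    (fun s => `|walsh_incr (walsh_sub t s)|)).
- by move=> j w; exact: normr_ge0.
- move=> j w; rewrite /cube_martingale histS walsh_walk_rcons addrAC subrr add0r.
  by rewrite /walsh_step /weight /=; case: (w _); rewrite ?normrN.
- apply/ess_supP; apply: aeW => w; apply: lime_le.
    by apply: is_cvg_ereal_nneg_natsum => k _; rewrite lee_fin powR_ge0.
  apply: nearW => m; rewrite sumEFin lee_fin (le_trans _ t1)//.
  case: m => [|m]; first by rewrite big_geq// walsh_cost_ge0.
  rewrite big_add1 /= big_mkord.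
  exact: (walsh_cost_branch t (fun i => w (inord i)) m p0).
Qed.

(** A discrete layer-cake bound: the sum counts the integers from 1 to [m] that are at most [y]. *)
Lemma le_sum_levels (R : realType) (y : R) m : y < m.+1%:R ->
  y <= 1 + \sum_(k < m) (k.+1%:R <= y)%R%:R.
Proof.
elim: m => [|m ih] ym; first by rewrite big_ord0 addr0 ltW.
have [my|ym'] := leP m.+1%:R y.
  rewrite (eq_bigr (fun=> 1)); last first.
    move=> k _; rewrite (le_trans _ my)// ler_nat.
    exact: ltn_ord.
  by rewrite sumr_const card_ord nat1r ltW.
by rewrite big_ord_recr/= (le_trans (ih ym'))// addrA lerDl.
Qed.

(** Averaging the layer-cake bound sums the tails at integer levels; they are dominated by a
    geometric series of ratio [q], whatever the tree and its depth. *)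
Lemma azuma_walsh_mean_bounded (R : realType) (X : normedModType R) (p : R) :
  1 < p -> azuma_type X p ->
  exists C0 : R, forall t : walsh X, walsh_cost p t <= 1 -> walsh_mean t 0 <= C0.
Proof.
move=> p1 azuma; have p0 : 0 < p by rewrite (lt_trans ltr01).
have [K [K0 tail_bound]] := azuma_walsh_tail p0 azuma.
set q := expR (- K^-1).
have q0 : 0 < q := expR_gt0 _.
have q1 : q < 1 by rewrite /q expR_lt1 oppr_lt0 invr_gt0.
exists (1 + 2 / (1 - q)) => t t1; set n := walsh_depth t.
have tn : (walsh_depth t <= n.+1)%N by rewrite /n.
rewrite (walsh_mean_cube tn); set N := #|{: cube n}|.
have tail := tail_bound _ _ tn t1.
set f := cube_martingale t n.+1 in tail *.
have [m fm] : exists m, forall w, `|f w| < m.+1%:R.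
  exists (Num.truncn (\sum_w `|f w|)) => w.
  rewrite (le_lt_trans _ (truncnS_gt _))//.
  by rewrite (bigD1 w)//= lerDl sumr_ge0.
have N0 : 0 < N%:R :> R.
  by rewrite ltr0n; apply/card_gt0P; exists point.
have -> : 1 + 2 / (1 - q) = N%:R^-1 * \sum_(w : cube n) 1 + 2 / (1 - q).
  by rewrite sumr_const mulVf ?gt_eqF.
apply: (@le_trans _ _ (N%:R^-1 * \sum_(w : cube n)
    (1 + \sum_(k < m) (k.+1%:R <= `|f w|)%R%:R))).
  rewrite ler_wpM2l ?invr_ge0//; apply: ler_sum => w _.
  exact: le_sum_levels.
rewrite big_split /= mulrDr lerD2l exchange_big /= mulr_sumr.
apply: (@le_trans _ _ (\sum_(k < m) 2 * q ^+ k)).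
  apply: ler_sum => k _; apply: (le_trans (tail _ (ltr0Sn _ k))).
  rewrite ler_pM2l// /q -expRM_natl ler_expR.
  rewrite mulNr mulrN lerN2 ler_pM2r ?invr_gt0//.
  (* As [p >= 1], the [p]-th power of [k + 1] is at least [k + 1], hence at least [k]. *)
  apply: (@le_trans _ _ k.+1%:R); first by rewrite ler_nat.
  rewrite -[leLHS]powRr1//; apply: ler_powR; last exact: ltW.
  by rewrite ler1n.
rewrite -mulr_sumr ler_pM2l// -[leRHS]mul1r ler_pdivlMr ?subr_gt0//.
have := subrX1 q m; have : 0 <= q ^+ m by rewrite exprn_ge0// ltW.
move: (\sum_(_ < _) _) => S; lra.
Qed.

Theorem theorem3p10 (R : realType) (p : R) (X : completeNormedModType R) :
  1 < p -> p <= 2 ->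
  separable_space X ->
  azuma_type X p ->
  exists Y : completeNormedModType R,
    lin_isomorphic X Y /\ p_uniformly_smooth Y p.
Proof.
move=> p1 _ _ /(azuma_walsh_mean_bounded p1)[C0 bounded].
have S0 : 0 <= walsh_sup p (0 : X).
  by rewrite (le_trans (normr_ge0 _) (norm_le_walsh_sup bounded _)).
pose N := gauge_norm (walsh_sup_convex bounded) (walsh_supN bounded)
  (walsh_sup_lip bounded) (norm_le_walsh_sup bounded).
exists (renormed_space N); split; first exact: renormed_lin_isomorphic.
(* The smoothness constant [C] is here [walsh_sup p 0], and the norm of [renormed_space N] is the
   gauge by definition. *)
have [s [s0 smooth]] := gauge_smooth p1 S0 (walsh_sup_convex bounded)
  (walsh_supN bounded) (walsh_sup_lip bounded) (norm_le_walsh_sup bounded)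
  (walsh_sup_smooth p1 bounded).
exists s; split => // tau tau0; apply: ge_ereal_sup => _ [x x1 [y y1 <-]].
by rewrite lee_fin; exact: smooth.
Qed.
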